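(* Let $\mathcal{G}$ be a maximal subgroup of the icosahedral group $\mathcal{I}$. Then for every $P \in \mathcal{C}_{B_6}(\mathcal{K}_{\mathcal{G}})$ there exist exactly two crystallographic representations of $\mathcal{I}$, $\mathcal{H}_1, \mathcal{H}_2 \in \mathcal{C}_{B_6}(\hat{\mathcal{I}})$, such that $P = \mathcal{H}_1 \cap \mathcal{H}_2$ (that is, there is exactly one unordered pair $\{\mathcal{H}_1,\mathcal{H}_2\}$ with this property).
   Context: $B_6 = O(6)\cap GL(6,\mathbb{Z})$ is the group of all $6\times 6$ signed permutation matrices. $\mathcal{I}\cong A_5$ is the (rotational) icosahedral group of order $60$, generated by $g_2,g_3$ with $g_2^2=g_3^3=(g_2g_3)^5=e$; $T_1,T_2$ are its two inequivalent $3$-dimensional real irreducible representations. A crystallographic representation of $\mathcal{I}$ in $B_6$ is a subgroup $\mathcal{H}\le B_6$ isomorphic to $\mathcal{I}$ whose natural action on $\mathbb{R}^6$ is equivalent in $GL(6,\mathbb{R})$ to $T_1\oplus T_2$. Let $\hat{\mathcal{I}}:\mathcal{I}\to B_6$ be the faithful representation determined on the standard basis $e_1,\dots,e_6$ of $\mathbb{R}^6$ by $\hat{\mathcal{I}}(g_2): e_1\mapsto e_6,\ e_2\mapsto e_5,\ e_3\mapsto -e_3,\ e_4\mapsto -e_4,\ e_5\mapsto e_2,\ e_6\mapsto e_1$ and $\hat{\mathcal{I}}(g_3): e_1\mapsto e_5,\ e_2\mapsto -e_3,\ e_3\mapsto -e_4,\ e_4\mapsto e_2,\ e_5\mapsto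 e_6,\ e_6\mapsto e_1$; its image, also denoted $\hat{\mathcal{I}}$, is a crystallographic representation of $\mathcal{I}$. For a subgroup $H$ of $B_6$, $\mathcal{C}_{B_6}(H)=\{gHg^{-1}:g\in B_6\}$. The set of all crystallographic representations of $\mathcal{I}$ in $B_6$ is $\mathcal{C}_{B_6}(\hat{\mathcal{I}})$. For a subgroup $\mathcal{G}\le\mathcal{I}$, $\mathcal{K}_{\mathcal{G}}:=\hat{\mathcal{I}}(\mathcal{G})\le\hat{\mathcal{I}}\le B_6$. The maximal (proper) subgroups of $\mathcal{I}$ are those isomorphic to the tetrahedral group $\mathcal{T}$ (order $12$), the dihedral group $\mathcal{D}_{10}$ of order $10$, or the dihedral group $\mathcal{D}_6$ of order $6$. *)

(* Defs.v *)
From HB Require Import structures.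
From mathcomp Require Import all_boot all_order all_algebra all_fingroup.
From mathcomp Require Import all_solvable mxrepresentation character reals.

Set Implicit Arguments.
Unset Strict Implicit.
Unset Printing Implicit Defensive.

Import Order.TTheory GRing.Theory Num.Theory.
Local Open Scope ring_scope.

(* O(n) :&: GL(n, Z): an integer matrix A with A A^T = 1 is automatically     *)
(* invertible over the integers.                                              *)
Record hyperoct (n : nat) : predArgType := Hyperoct {
  hyperoct_mx :> 'M[int]_n;
  hyperoct_orth : hyperoct_mx *m hyperoct_mx^T == 1%:M
}.

HB.instance Definition _ n := [isSub for @hyperoct_mx n].
HB.instance Definition _ n := [Countable of hyperoct n by <:].

Section HyperoctFinite.
Variable n : nat.
Implicit Types A B : hyperoct n.

Lemma hyperoct_mulmxT A : A *m A^T = 1%:M.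
Proof. exact/eqP/hyperoct_orth. Qed.

Lemma hyperoct_trmxK A : A^T *m A = 1%:M.
Proof. exact/mulmx1C/hyperoct_mulmxT. Qed.

Lemma hyperoct_sqr_sum A i : \sum_j A i j ^+ 2 = 1.
Proof.
have /matrixP/(_ i i) := hyperoct_mulmxT A.
rewrite !mxE eqxx mulr1n => <-; apply: eq_bigr => j _.
by rewrite mxE expr2.
Qed.

Lemma hyperoct_sqr_le1 A i j : A i j ^+ 2 <= 1.
Proof.
rewrite -(hyperoct_sqr_sum A i) (bigD1 j) //= lerDl.
by apply: sumr_ge0 => k _; exact: sqr_ge0.
Qed.

Lemma hyperoct_entry A i j : A i j \in [:: 0; 1; -1].
Proof.
have := hyperoct_sqr_le1 A i j.
by case: (A i j) => [[|[|k]]|[|k]].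
Qed.

Definition hyperoct_code A : 'M[option bool]_n :=
  map_mx (fun z : int => if z == 0 then None else Some (z == 1)) A.

Definition hyperoct_decode (M : 'M[option bool]_n) : option (hyperoct n) :=
  insub (map_mx (fun o => if o is Some b then if b then 1 else -1 else 0) M).

Lemma hyperoct_codeK : pcancel hyperoct_code hyperoct_decode.
Proof.
move=> A; rewrite /hyperoct_decode.
rewrite [map_mx _ _](_ : _ = A :> 'M_n) ?valK //.
apply/matrixP => i j; rewrite !mxE.
by have := hyperoct_entry A i j; rewrite !inE => /or3P[]/eqP->.
Qed.

End HyperoctFinite.

HB.instance Definition _ n : isFinite (hyperoct n) :=
  PCanIsFinite (@hyperoct_codeK n).

Section HyperoctGroup.
Variable n : nat.
Implicit Types A B C : hyperoct n.

Fact hyperoct_mul_subproof A B : (A *m B) *m (A *m B)^T == 1%:M.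
Proof.
by rewrite trmx_mul mulmxA -(mulmxA _ (B : 'M_n)) !(hyperoct_mulmxT, mulmx1).
Qed.

Fact hyperoct_one_subproof : 1%:M *m 1%:M^T == 1%:M :> 'M[int]_n.
Proof. by rewrite trmx1 mulmx1. Qed.

Fact hyperoct_inv_subproof A : A^T *m A^T^T == 1%:M.
Proof. by rewrite trmxK hyperoct_trmxK. Qed.

Definition hyperoct_mul A B := Hyperoct (hyperoct_mul_subproof A B).
Definition hyperoct_one := Hyperoct hyperoct_one_subproof.
Definition hyperoct_inv A := Hyperoct (hyperoct_inv_subproof A).

Fact hyperoct_mulA : associative hyperoct_mul.
Proof. by move=> A B C; apply/val_inj; rewrite /= mulmxA. Qed.

Fact hyperoct_mul1 : left_id hyperoct_one hyperoct_mul.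
Proof. by move=> A; apply/val_inj; rewrite /= mul1mx. Qed.

Fact hyperoct_mulV : left_inverse hyperoct_one hyperoct_inv hyperoct_mul.
Proof. by move=> A; apply/val_inj; rewrite /= hyperoct_trmxK. Qed.

End HyperoctGroup.

HB.instance Definition _ n := Finite_isGroup.Build (hyperoct n)
  (@hyperoct_mulA n) (@hyperoct_mul1 n) (@hyperoct_mulV n).

Notation B6 := (hyperoct 6).

(* C_{B_6}(H) = {g H g^-1 : g in B_6}.                                        *)
Definition conj_class (H : {set B6}) : {set {set B6}} :=
  (H :^: [set: B6])%g.

(* The standard basis, numbered from 1 to 6; matrices act on column vectors.  *)
Definition basis_vec (k : nat) : 'cV[int]_6 := delta_mx (inord k.-1) 0.

Definition basis_images (A : B6) : seq 'cV[int]_6 :=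
  [seq A *m basis_vec k | k <- iota 1 6].

Definition Ihat_g2_images : seq 'cV[int]_6 :=
  let e := basis_vec in [:: e 6; e 5; - e 3; - e 4; e 2; e 1].

Definition Ihat_g3_images : seq 'cV[int]_6 :=
  let e := basis_vec in [:: e 5; - e 3; - e 4; e 2; e 6; e 1].

Section Crystallographic.
Variables (R : realType) (gT : finGroupType) (I : {group gT}).

Fact natural_mx_repr (f : {morphism I >-> B6}) :
  mx_repr I (fun x => map_mx intr (f x : 'M[int]_6) : 'M[R]_6).
Proof.
split=> [|x y Ix Iy]; first by rewrite morph1 map_mx1.
by rewrite morphM // map_mxM.
Qed.

Definition natural_repr (f : {morphism I >-> B6}) : mx_representation R I 6 :=
  MxRepresentation (natural_mx_repr f).

(* The two 3-dimensional real irreducible representations T1, T2 of I are     *)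
(* unique up to equivalence and order, so that naming them amounts to asking  *)
(* for two inequivalent ones.                                                 *)
Definition crystallographic (H : {group B6}) : Prop :=
  exists2 f : {morphism I >-> B6}, ('injm f /\ f @* I = H)%g &
  exists T1 T2 : mx_representation R I 3,
    [/\ mx_irreducible T1, mx_irreducible T2, ~ mx_rsim T1 T2 &
        mx_rsim (natural_repr f)
                (dadd_grepr (Representation T1) (Representation T2))].

End Crystallographic.

(* Main.v *)
From HB Require Import structures.
Require Import Defs.
From mathcomp Require Import all_boot all_order all_algebra all_fingroup.
From mathcomp Require Import all_solvable mxrepresentation character.
From mathcomp Require Import integral_char reals.

(** Idea of the proof. The group Ihat preserves a conference matrix C of order 6: a
symmetric matrix with zero diagonal, entries 1 and -1 elsewhere, and C^2 = 5. It
records the angles between the six diagonals of the icosahedron. The stabiliser of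
C in B6, for the action C^g = g^T C g, is Ihat times {1, -1}, and some element
normalising Ihat sends C to -C. A conjugate Ihat^g of Ihat is therefore the same
thing as a pair {C^g, -C^g} ([icosaJ_eq]), and the question becomes: which matrices
C^g, up to sign, are fixed by K_G?

A proper subgroup of Ihat is solvable: as Ihat is simple it has no subgroup of
order 30, and the other orders involve at most two primes. So a maximal subgroup G
normalises a nontrivial p-group. Since the Sylow subgroups of the icosahedral group
intersect trivially, G is, up to conjugacy, contained in the normaliser of a fixed
Sylow p-subgroup, for p = 2, 3 or 5 ([proper_in_common]). For each p there is an
element h such that this normaliser is exactly the subgroup E of the elements of
Ihat that fix C^h; by maximality, G is conjugate to E.

Suppose that E fixes T = C^g. As C and T are both invariant under the same signed
permutations, the signs cancel in the entrywise product of T and C: it is a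
symmetric function on pairs of lines, constant on the orbits of E. There are only
two, three or four orbits, and among the corresponding rescalings of C the relation
T T^T = 5 leaves C, C^h and their opposites ([twin_unique]). So exactly two
conjugates of Ihat contain K_G, namely Ihat and Ihat^h, and by maximality they meet
in K_G. Conversely two conjugates whose intersection is K_G both contain it and
are distinct, because K_G is a proper subgroup of Ihat.

That the conjugates are crystallographic representations comes from C as well: over
the reals, its eigenspaces for sqrt 5 and - sqrt 5 are two submodules of dimension
3. They are simple ([eigen_simple]) because averaging over the rotations about one
diagonal produces a generator from any suitable vector, and they are not isomorphic
([eigen_not_iso]) because 2 + 2 C is a sum of group elements.

Statements about the finitely many elements of B6 involved are decided by
computation on codes of signed permutations. *)

Set Implicit Arguments.
Unset Strict Implicit.
Unset Printing Implicit Defensive.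

Import Order.TTheory GRing.Theory Num.Theory GroupScope.
Local Open Scope ring_scope.

Implicit Types (u v : nat) (c d : seq nat) (x y g : B6).

(** * Signed permutations as actions on twelve vertices *)

(** The twelve vertices e_1, ..., e_6, -e_1, ..., -e_6 of the cross-polytope are
numbered 0, ..., 11: [k] stands for e_(k+1) and [k + 6] for its opposite. *)
Definition antipode v := if (v < 6)%N then (v + 6)%N else (v - 6)%N.
Definition line v := if (v < 6)%N then v else (v - 6)%N.
Definition vsign v : int := if (v < 6)%N then 1 else -1.
Definition vcoord v i : int := if i == line v then vsign v else 0.
Definition vtx v : 'cV[int]_6 := \col_i vcoord v i.

Lemma antipode_lt v : (v < 12)%N -> (antipode v < 12)%N.
Proof.
rewrite /antipode; case: (ltnP v 6) => [v6 _|v6 v12]; first by rewrite addnC -ltn_subRL.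
exact: leq_ltn_trans (leq_subr _ _) v12.
Qed.

Lemma vtx_antipode v : (v < 12)%N -> vtx (antipode v) = - vtx v.
Proof.
move=> v12; apply/colP=> i; rewrite !mxE /vcoord /antipode /line /vsign.
have [v6|v6] := ltnP v 6.
  by rewrite ltnNge leq_addl addnK; case: eqP => //= _; rewrite oppr0.
by rewrite ltn_subLR // v12; case: eqP => //= _; rewrite ?opprK ?oppr0.
Qed.

Lemma basis_vecE v : (v < 6)%N -> basis_vec v.+1 = vtx v.
Proof.
move=> v6; apply/colP=> i; rewrite !mxE /vcoord /line /vsign v6 eqxx andbT.
by rewrite -val_eqE /= inordK //; case: eqP.
Qed.

Lemma vtx_eq u v : (u < 12)%N -> (v < 12)%N -> (vtx u == vtx v) = (u == v).
Proof.
move=> u12 v12; apply/eqP/eqP=> [|-> //] /colP uv; apply/eqP; move: u12 v12.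
have {}uv : all (fun i => vcoord u i == vcoord v i) (iota 0 6).
  apply/allP=> i; rewrite mem_iota /= => i6.
  by have := uv (Ordinal i6); rewrite !mxE => ->.
have : all (fun u => all (fun v => all (fun i => vcoord u i == vcoord v i) (iota 0 6)
   ==> (u == v)) (iota 0 12)) (iota 0 12) by vm_compute.
move=> /allP H u12 v12; have /allP/(_ v) := H u ltac:(by rewrite mem_iota).
by rewrite mem_iota => /(_ v12)/implyP/(_ uv).
Qed.

Definition vertices := mkseq vtx 12.

Lemma mem_vertices v : (v < 12)%N -> vtx v \in vertices.
Proof. by move=> v12; apply: map_f; rewrite mem_iota. Qed.

Lemma index_vtx v : (v < 12)%N -> index (vtx v) vertices = v.
Proof.
move=> v12; have -> : vtx v = nth 0 vertices v.
  by rewrite nth_mkseq.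
rewrite index_uniq ?size_mkseq // /vertices /mkseq.
rewrite map_inj_in_uniq ?iota_uniq // => u w.
by rewrite !mem_iota => u12 w12 /eqP; rewrite vtx_eq // => /eqP.
Qed.

(** A signed permutation matrix is encoded by the vertices to which it sends
e_1, ..., e_6, so that finite verifications about B6 become computations on
lists of numbers. Locked: otherwise unification would unfold the search through
the vertices. *)
HB.lock Definition code x : seq nat :=
  mkseq (fun k => index (x *m vtx k) vertices) 6.

Lemma size_code x : size (code x) = 6%N.
Proof. by rewrite code.unlock size_mkseq. Qed.

Lemma nth_code x k : (k < 6)%N ->
  nth 0%N (code x) k = index (x *m vtx k) vertices.
Proof. by move=> k6; rewrite code.unlock nth_mkseq. Qed.

Lemma vtx_delta (i : 'I_6) : vtx i = delta_mx i 0.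
Proof. by rewrite -basis_vecE // /basis_vec /= inord_val. Qed.

Lemma mulmx_vtxE (A : 'M[int]_6) (i k : 'I_6) : (A *m vtx k) i 0 = A i k.
Proof. by rewrite vtx_delta -colE mxE. Qed.

(** An orthogonal integer matrix has columns of norm 1, hence each column has a
single nonzero entry, equal to 1 or -1. *)
Lemma mulmx_vtx_mem x k : (k < 6)%N -> x *m vtx k \in vertices.
Proof.
move=> k6.
have sq1 : \sum_i (x *m vtx k) i 0 ^+ 2 = 1.
  (* the rows of x^-1 are the columns of x *)
  rewrite -(hyperoct_sqr_sum x^-1%g (Ordinal k6)); apply: eq_bigr => i _.
  by rewrite (mulmx_vtxE x i (Ordinal k6)) mxE.
have [i xi] : exists i, (x *m vtx k) i 0 != 0.
  apply/existsP; apply: contra_eqT sq1 => /existsPn x0.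
  by rewrite big1 // => i _; have := x0 i; rewrite negbK => /eqP->; rewrite expr0n.
have xi1 : (x *m vtx k) i 0 = 1 \/ (x *m vtx k) i 0 = -1.
  have := hyperoct_entry x i (Ordinal k6).
  rewrite -mulmx_vtxE !inE (negPf xi) /=.
  by case/orP=> /eqP->; [left | right].
have xi2 : (x *m vtx k) i 0 ^+ 2 = 1 by case: xi1 => ->.
have xj j : j != i -> (x *m vtx k) j 0 = 0.
  move=> ji; move: sq1; rewrite (bigD1 i) //= xi2 -[RHS]addr0 => /addrI.
  move/psumr_eq0P => /(_ (fun j _ => sqr_ge0 _) j ji)/eqP.
  by rewrite sqrf_eq0 => /eqP.
have xE : x *m vtx k = (x *m vtx k) i 0 *: vtx i.
  apply/colP => j; rewrite [RHS]mxE [vtx i j 0]mxE /vcoord /line /vsign ltn_ord val_eqE.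
  by have [->|/xj->] := eqVneq j i; rewrite ?mulr1 ?mulr0.
have i12 : (i < 12)%N by apply: leq_trans (ltn_ord i) _.
case: xi1 xE => -> ->; first by rewrite scale1r mem_vertices.
by rewrite scaleN1r -vtx_antipode // mem_vertices // antipode_lt.
Qed.

Lemma nth_code_lt x k : (k < 6)%N -> (nth 0%N (code x) k < 12)%N.
Proof.
move=> k6; rewrite nth_code //.
by have := mulmx_vtx_mem x k6; rewrite -index_mem size_mkseq.
Qed.

Lemma mulmx_vtx x k : (k < 6)%N -> x *m vtx k = vtx (nth 0%N (code x) k).
Proof.
move=> k6; rewrite nth_code //; have xk := mulmx_vtx_mem x k6.
have xk12 := xk; rewrite -index_mem size_mkseq in xk12.
by rewrite -[LHS](nth_index 0 xk) nth_mkseq.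
Qed.

(** The code of a matrix only records its action on e_1, ..., e_6; linearity
gives the action on the six other vertices. *)
Definition vact c v := if (v < 6)%N then nth 0%N c v else antipode (nth 0%N c (v - 6)).
Definition cmul c d := [seq vact c v | v <- d].

Lemma mulmx_vact x v : (v < 12)%N -> x *m vtx v = vtx (vact (code x) v).
Proof.
move=> v12; rewrite /vact; case: (ltnP v 6) => v6; first exact: mulmx_vtx.
have v6' : (v - 6 < 6)%N by rewrite ltn_subLR.
have vE : v = antipode (v - 6) by rewrite /antipode v6' subnK.
rewrite [in LHS]vE !vtx_antipode ?nth_code_lt ?mulmxN ?mulmx_vtx //.
exact: leq_trans v6' _.
Qed.

Lemma vact_lt x v : (v < 12)%N -> (vact (code x) v < 12)%N.
Proof.
move=> v12; rewrite /vact; case: (ltnP v 6) => v6; first exact: nth_code_lt.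
by apply/antipode_lt/nth_code_lt; rewrite ltn_subLR.
Qed.

Lemma codeM x y : code (x * y)%g = cmul (code x) (code y).
Proof.
apply: (@eq_from_nth _ 0%N) => [|k]; rewrite ?size_map !size_code // => k6.
rewrite nth_code // (nth_map 0%N) ?size_code //.
rewrite -mulmxA mulmx_vtx // mulmx_vact ?nth_code_lt //.
by rewrite index_vtx // vact_lt // nth_code_lt.
Qed.

Lemma code_inj : injective code.
Proof.
move=> x y xy; apply/val_inj/matrixP => i k.
by rewrite -!mulmx_vtxE !mulmx_vtx ?xy.
Qed.

Lemma code1 : code 1%g = iota 0 6.
Proof.
rewrite code.unlock /mkseq -[RHS]map_id; apply/eq_in_map => k; rewrite mem_iota => k6.
by rewrite mul1mx index_vtx // (leq_trans k6).
Qed.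

Definition entry (t : seq (seq int)) i j : int := nth 0 (nth [::] t i) j.

Definition table (t : seq (seq int)) : 'M[int]_6 := \matrix_(i, j) entry t i j.

(** The value on the vertices [u] and [v] of the bilinear form with matrix [t]. *)
Definition gram (t : seq (seq int)) u v : int :=
  vsign u * vsign v * entry t (line u) (line v).

Lemma line_lt v : (v < 12)%N -> (line v < 6)%N.
Proof. by rewrite /line; case: (ltnP v 6) => // v6 v12; rewrite ltn_subLR. Qed.

Lemma vtxE v (v12 : (v < 12)%N) :
  vtx v = vsign v *: delta_mx (Ordinal (line_lt v12)) 0.
Proof.
apply/colP => i; rewrite !mxE /vcoord andbT -val_eqE /=.
by case: eqP => _; rewrite ?mulr1 ?mulr0.
Qed.

Lemma gramE t u v : (u < 12)%N -> (v < 12)%N ->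
  ((vtx u)^T *m table t *m vtx v) 0 0 = gram t u v.
Proof.
move=> u12 v12; rewrite (vtxE u12) (vtxE v12) [X in X *m _ *m _]linearZ /= trmx_delta.
by rewrite -!scalemxAl -scalemxAr -rowE -colE !mxE mulrA.
Qed.

(** The right action of B6 on bilinear forms. As x is orthogonal, it is also
conjugation by x^-1, and the matrices fixed by x are those commuting with x. *)
Definition pull (A : 'M[int]_6) x : 'M[int]_6 := x^T *m A *m x.

Lemma pullE t x (i j : 'I_6) :
  pull (table t) x i j = gram t (nth 0%N (code x) i) (nth 0%N (code x) j).
Proof.
rewrite -gramE ?nth_code_lt // -!mulmx_vtx // trmx_mul /pull.
have -> : (vtx i)^T *m x^T *m table t *m (x *m vtx j)
    = (vtx i)^T *m (x^T *m table t *m x) *m vtx j by rewrite !mulmxA.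
by rewrite !vtx_delta trmx_delta -rowE -colE !mxE.
Qed.

Lemma pull1 A : pull A 1%g = A.
Proof. by rewrite /pull trmx1 mul1mx mulmx1. Qed.

Lemma pullM A x y : pull A (x * y)%g = pull (pull A x) y.
Proof. by rewrite /pull trmx_mul !mulmxA. Qed.

Lemma pullN A x : pull (- A) x = - pull A x.
Proof. by rewrite /pull mulmxN mulNmx. Qed.

Lemma pull_commP (A : 'M[int]_6) x : pull A x = A <-> A *m x = x *m A.
Proof.
split=> [Ax | Ax].
  by rewrite -[in RHS]Ax /pull !mulmxA hyperoct_mulmxT mul1mx.
by rewrite /pull -mulmxA Ax mulmxA hyperoct_trmxK mul1mx.
Qed.

(** This is how explicit elements of B6 are produced from their codes. *)
Lemma code_surj c : size c = 6%N -> all (fun v => v < 12)%N c ->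
  uniq (map line c) -> exists x, code x = c.
Proof.
move=> c6 /allP c12 cU.
pose A : 'M[int]_6 := \matrix_(i, k) vtx (nth 0%N c k) i 0.
have lt12 k : (k < 6)%N -> (nth 0%N c k < 12)%N.
  by move=> k6; apply/c12/mem_nth; rewrite c6.
have AE (k : 'I_6) : A *m vtx k = vtx (nth 0%N c k).
  by apply/colP => i; rewrite vtx_delta -colE !mxE.
have orthA : A *m A^T == 1%:M.
  apply/eqP/mulmx1C/matrixP => i j.
  have -> : (A^T *m A) i j = ((vtx (nth 0%N c i))^T *m vtx (nth 0%N c j)) 0 0.
    by rewrite !mxE; apply: eq_bigr => k _; rewrite !mxE.
  rewrite (vtxE (lt12 i (ltn_ord i))) (vtxE (lt12 j (ltn_ord j))).
  rewrite [X in X *m _]linearZ /= trmx_delta -scalemxAl -scalemxAr mul_delta_mx_cond.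
  have lineE : (line (nth 0%N c i) == line (nth 0%N c j)) = (i == j).
    by rewrite -!(nth_map _ 0%N line) ?c6 // nth_uniq // size_map c6.
  rewrite -val_eqE /= lineE.
  have [->|/negPf ij] := eqVneq i j; last by rewrite mulr0n !scaler0 !mxE ij.
  by rewrite mulr1n scalerA /vsign; case: ifP; rewrite ?mulrNN mulr1 scale1r !mxE !eqxx.
exists (Hyperoct orthA); apply: (@eq_from_nth _ 0%N) => [|k].
  by rewrite size_code c6.
rewrite size_code => k6; rewrite nth_code //.
by rewrite -[X in X *m _]/A (AE (Ordinal k6)) index_vtx // lt12.
Qed.

(** * The icosahedral group and its conference matrix *)

(** The images of the generators g_2 and g_3. *)
Definition code2 := [:: 5; 4; 8; 9; 1; 0]%N.
Definition code3 := [:: 4; 8; 9; 1; 5; 0]%N.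

(** Twelve rounds of right multiplication by the generators exhaust the group. *)
Definition icosa_codes : seq (seq nat) :=
  iter 12 (fun s => undup (s ++ [seq cmul c d | c <- s, d <- [:: code2; code3]]))
    [:: iota 0 6].

Definition icosa : {set B6} := [set x | code x \in icosa_codes].

Lemma mem_icosa x : (x \in icosa) = (code x \in icosa_codes).
Proof. by rewrite inE. Qed.

Lemma icosa_codes1 : iota 0 6 \in icosa_codes.
Proof. by vm_compute. Qed.

Lemma icosa_codesM :
  all (fun c => all (fun d => cmul c d \in icosa_codes) icosa_codes) icosa_codes.
Proof. by vm_compute. Qed.

Fact icosa_group_set : group_set icosa.
Proof.
apply/group_setP; split=> [|x y]; rewrite !mem_icosa; first by rewrite code1 icosa_codes1.
by rewrite codeM => /(allP icosa_codesM)/allP; apply.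
Qed.
Canonical icosa_group := Group icosa_group_set.

Lemma icosa_codes_valid : all (fun c =>
  [&& size c == 6, all (fun v => v < 12)%N c & uniq (map line c)]) icosa_codes.
Proof. by vm_compute. Qed.

Lemma icosa_codesP c : c \in icosa_codes -> exists2 x, x \in icosa & code x = c.
Proof.
move=> cI; suff [x xc] : exists x, code x = c by exists x; rewrite ?mem_icosa xc.
by have /and3P[/eqP c6 c12 cU] := allP icosa_codes_valid c cI; apply: code_surj.
Qed.

Lemma card_code_set (s : seq (seq nat)) :
  uniq s -> {subset s <= icosa_codes} -> #|[set x | code x \in s]| = size s.
Proof.
move=> sU sI; rewrite cardE -(size_map code); apply/perm_size/uniq_perm;
  [ | exact: sU | move=> c].
  by rewrite (map_inj_uniq code_inj) enum_uniq.
apply/mapP/idP => [[x] |cs]; first by rewrite mem_enum inE => xs ->.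
by have [x _ xc] := icosa_codesP (sI c cs); exists x; rewrite // mem_enum inE xc.
Qed.

Lemma icosa_codes_uniq : uniq icosa_codes.
Proof. by vm_compute. Qed.

Lemma size_icosa_codes : size icosa_codes = 60%N.
Proof. by vm_compute. Qed.

Lemma card_icosa : #|icosa| = 60%N.
Proof.
by rewrite -size_icosa_codes card_code_set ?icosa_codes_uniq.
Qed.

(** The conference matrix of order 6. Unit vectors along the six diagonals of a
regular icosahedron have Gram matrix 1 + C / sqrt 5 for suitable orientations,
which is why the icosahedral group, acting by signed permutations of these
diagonals, preserves C. *)
Definition conf : seq (seq int) :=
  [:: [::  0;  1; -1; -1;  1;  1];
      [::  1;  0;  1; -1; -1;  1];
      [:: -1;  1;  0;  1; -1;  1];
      [:: -1; -1;  1;  0;  1;  1];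
      [::  1; -1; -1;  1;  0;  1];
      [::  1;  1;  1;  1;  1;  0]].

Local Notation C := (table conf).

(** Tables in this normal form are determined by their entries, so that an
equality of matrices can be tested as an equality of lists. *)
Definition mktable (f : nat -> nat -> int) := mkseq (fun i => mkseq (f i) 6) 6.
Definition tpull t c := mktable (fun i j => gram t (nth 0%N c i) (nth 0%N c j)).
Definition topp (t : seq (seq int)) := map (map -%R) t.

Lemma nth_mktable f i j : (i < 6)%N -> (j < 6)%N ->
  entry (mktable f) i j = f i j.
Proof. by move=> i6 j6; rewrite /entry !nth_mkseq. Qed.

Lemma pull_table t x : pull (table t) x = table (tpull t (code x)).
Proof. by apply/matrixP=> i j; rewrite pullE mxE nth_mktable. Qed.

Lemma mktable_eq (f f' : nat -> nat -> int) :
  (forall i j, (i < 6)%N -> (j < 6)%N -> f i j = f' i j) -> mktable f = mktable f'.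
Proof.
move=> ff'; apply/eq_in_map => i; rewrite mem_iota => i6.
by apply/eq_in_map => j; rewrite mem_iota => j6; apply: ff'.
Qed.

Lemma table_mktable_inj (f f' : nat -> nat -> int) :
  table (mktable f) = table (mktable f') -> mktable f = mktable f'.
Proof.
move=> /matrixP ff'; apply: mktable_eq => i j i6 j6.
by have := ff' (Ordinal i6) (Ordinal j6); rewrite !mxE !nth_mktable.
Qed.

Lemma icosa_codes_conf : all (fun c => tpull conf c == conf) icosa_codes.
Proof. by vm_compute. Qed.

Lemma icosa_conf x : x \in icosa -> pull C x = C.
Proof.
by rewrite mem_icosa pull_table => /(allP icosa_codes_conf)/eqP->.
Qed.

(** * The stabiliser of the conference matrix *)

(** The codes of the icosahedral group and of its product with -1. *)
Definition stab_codes := icosa_codes ++ [seq map antipode c | c <- icosa_codes].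

Lemma size_stab_codes : all (fun d => size d == 6%N) stab_codes.
Proof. by vm_compute. Qed.

(** The group generated by the icosahedral group and -1 is transitive on the
triples of vertices with the same mutual products as e_1, e_2, e_3. *)
Lemma stab_codes_triple :
  all (fun u => all (fun v => all (fun w =>
    [&& gram conf u v == entry conf 0 1, gram conf u w == entry conf 0 2
      & gram conf v w == entry conf 1 2] ==>
    has (fun d => take 3 d == [:: u; v; w]) stab_codes)
  (iota 0 12)) (iota 0 12)) (iota 0 12).
Proof. by vm_compute. Qed.

(** A vertex is determined by its products with three vertices that are placed
like e_1, e_2, e_3. *)
Lemma stab_codes_next :
  all (fun d => all (fun k => all (fun v =>
    all (fun j => gram conf (nth 0%N d j) v == entry conf j k) (iota 0 3) ==>
    (v == nth 0%N d k)) (iota 0 12)) (iota 0 6)) stab_codes.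
Proof. by vm_compute. Qed.

Lemma pull_confE x i j : pull C x = C -> (i < 6)%N -> (j < 6)%N ->
  gram conf (nth 0%N (code x) i) (nth 0%N (code x) j) = entry conf i j.
Proof.
move=> xC i6 j6; have := pullE conf x (Ordinal i6) (Ordinal j6).
by rewrite xC mxE => <-.
Qed.

(** The stabiliser of C is the icosahedral group times {1, -1}: an element of
this product agrees with x on the first three basis vectors, and the images of
the three others are then forced by their products with these. *)
Lemma code_stab x : pull C x = C -> code x \in stab_codes.
Proof.
move=> xC.
have c12 k : (k < 6)%N -> nth 0%N (code x) k \in iota 0 12.
  by move=> k6; rewrite mem_iota nth_code_lt.
have /allP/(_ _ (c12 1%N isT))/allP/(_ _ (c12 2%N isT)) :=
  allP stab_codes_triple _ (c12 0%N isT).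
rewrite (pull_confE xC (isT : 0 < 6)%N (isT : 1 < 6)%N) eqxx.
rewrite (pull_confE xC (isT : 0 < 6)%N (isT : 2 < 6)%N) eqxx.
rewrite (pull_confE xC (isT : 1 < 6)%N (isT : 2 < 6)%N) eqxx.
case/hasP=> d dS /eqP d3.
have d3E j : (j < 3)%N -> nth 0%N d j = nth 0%N (code x) j.
  move=> j3; rewrite -(nth_take 0%N j3) d3.
  by case: j j3 => [|[|[|]]].
have /eqP d6 := allP size_stab_codes d dS.
suff -> : code x = d by exact: dS.
apply: (@eq_from_nth _ 0%N) => [|k]; first by rewrite size_code d6.
rewrite size_code => k6; have k6' : k \in iota 0 6 by rewrite mem_iota.
have /allP/(_ _ k6')/allP/(_ _ (c12 k k6))/implyP := allP stab_codes_next _ dS.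
move=> H; apply/eqP/H/allP => j; rewrite mem_iota => j3.
have j6 : (j < 6)%N := leq_trans j3 (isT : 3 <= 6)%N.
by rewrite (d3E _ j3) (pull_confE xC j6 k6).
Qed.

(** The factor -1 is central, so it does not affect conjugation. *)
Lemma stab_conj x : pull C x = C ->
  exists2 y, y \in icosa & forall z, (z ^ x = z ^ y)%g.
Proof.
move/code_stab; rewrite mem_cat => /orP[xI|/mapP[c cI xc]].
  by exists x; rewrite ?mem_icosa.
have [y yI yc] := icosa_codesP cI; exists y; [exact: yI | move=> z].
have xk (k : 'I_6) : x *m vtx k = - (y *m vtx k).
  have k6 := ltn_ord k; rewrite (mulmx_vtx x k6) (mulmx_vtx y k6) xc yc.
  rewrite (nth_map 0%N) ?vtx_antipode -?yc ?nth_code_lt ?size_code //.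
have xN : val x = - val y.
  apply/matrixP => i k.
  by rewrite -[LHS]mulmx_vtxE xk [LHS]mxE mulmx_vtxE [RHS]mxE.
by apply/val_inj; rewrite /= xN linearN /= mulNmx mulmxN mulmxN opprK.
Qed.

Definition stab (A : 'M[int]_6) : {set B6} := [set x | pull A x == A].

Lemma stabP (A : 'M[int]_6) x : reflect (pull A x = A) (x \in stab A).
Proof. by rewrite inE; apply: eqP. Qed.

Fact stab_group_set (A : 'M[int]_6) : group_set (stab A).
Proof.
apply/group_setP; split=> [|x y /stabP xA /stabP yA]; apply/stabP.
  exact: pull1.
by rewrite pullM xA.
Qed.
Canonical stab_group (A : 'M[int]_6) := Group (stab_group_set A).

Lemma stabJ (A : 'M[int]_6) g : stab A :^ g = stab (pull A g).
Proof.
apply/setP=> x; rewrite mem_conjg.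
have gx : pull (pull A g) x = pull (pull A (x ^ g^-1)%g) g.
  by rewrite -!pullM (conjgC (x ^ g^-1)%g) conjgKV.
apply/stabP/stabP => [xA|]; first by rewrite gx xA.
rewrite gx => /(congr1 (fun B => pull B g^-1%g)).
by rewrite -!pullM -mulgA mulgV mulg1 pull1.
Qed.

Lemma icosa_sub_stab : icosa \subset stab C.
Proof. by apply/subsetP => x /icosa_conf/stabP. Qed.

Lemma icosaJ_stab g : icosa :^ g \subset stab (pull C g).
Proof. by rewrite -stabJ conjSg icosa_sub_stab. Qed.

(** The code [c] conjugates [d] into the icosahedral group: with c d = e c, one has
e = c d c^-1. *)
Definition intertwines c d := cmul c d \in [seq cmul e c | e <- icosa_codes].

Lemma mem_icosaJ g x : intertwines (code g) (code x) -> x \in icosa :^ g.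
Proof.
case/mapP=> d dI; have [y yI <-] := icosa_codesP dI.
rewrite -!codeM => /code_inj gx; rewrite mem_conjg.
by rewrite conjgE invgK mulgA gx mulgK.
Qed.

Definition code_flip : seq nat := [:: 0; 2; 4; 1; 3; 11]%N.

(** The normaliser of the icosahedral group also contains elements that realise
its outer automorphism; they exchange the eigenspaces of C, hence negate C. *)
Lemma exists_flip : exists g, icosa :^ g = icosa /\ pull C g = - C.
Proof.
have [g gE] : exists g, code g = code_flip by apply: code_surj.
exists g; split; last first.
  rewrite pull_table gE; apply/matrixP => i j; rewrite !mxE; move: i j.
  have H : all (fun i => all (fun j => entry (tpull conf code_flip) i j == - entry conf i j)
     (iota 0 6)) (iota 0 6) by vm_compute.
  move=> i j; have /allP/(_ (val j)) := allP H (val i) ltac:(by rewrite mem_iota ltn_ord).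
  by rewrite mem_iota ltn_ord => /(_ isT)/eqP.
apply/esym/eqP; rewrite eqEcard cardJg leqnn andbT; apply/subsetP => x.
rewrite mem_icosa => xI; apply: mem_icosaJ; rewrite gE.
have /allP/(_ _ xI) // : all (fun c => intertwines code_flip c) icosa_codes.
by vm_compute.
Qed.

(** * Conjugates of the icosahedral group *)

(** A conjugate of the icosahedral group is thus determined by its conference
matrix up to sign: up to the flip, the quotient of two conjugating elements
stabilises C, hence acts on the icosahedral group as one of its members. *)
Lemma icosaJ_eq g h : pull C g = pull C h \/ pull C g = - pull C h ->
  icosa :^ g = icosa :^ h.
Proof.
have [n [nI nC]] := exists_flip.
wlog: g / pull C g = pull C h => [wl [gh|gh]|gh _].
- by apply: wl => //; left.
- rewrite -(wl (n * g)%g); first by rewrite conjsgM nI.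
    by rewrite pullM nC pullN gh opprK.
  by left; rewrite pullM nC pullN gh opprK.
have /stab_conj[y yI gy] : pull C (g * h^-1)%g = C.
  by rewrite pullM gh -pullM mulgV pull1.
have ghI : icosa :^ (g * h^-1) = icosa.
  rewrite -[RHS](conjGid (G := icosa_group) yI); apply/eq_in_imset => z _.
  exact: gy.
by rewrite -[in RHS]ghI -conjsgM mulgKV.
Qed.

Definition sumz (s : seq int) : int := foldr +%R 0 s.

Lemma sum_iota (f : nat -> int) : \sum_(i < 6) f i = sumz (mkseq f 6).
Proof. by rewrite !big_ord_recl big_ord0. Qed.

(** The test T T^T = 5 on tables; every C^g passes it. *)
Definition orthogonal_rows (t : seq (seq int)) :=
  all (fun i => all (fun j =>
    sumz (mkseq (fun k => entry t i k * entry t j k) 6) == (if i == j then 5 else 0))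
  (iota 0 6)) (iota 0 6).

Lemma gram_mem : all (fun u => all (fun v => gram conf u v \in [:: 0; 1; -1])
  (iota 0 12)) (iota 0 12).
Proof. by vm_compute. Qed.

Lemma gram_sym : all (fun u => all (fun v => gram conf u v == gram conf v u)
  (iota 0 12)) (iota 0 12).
Proof. by vm_compute. Qed.

Lemma gram_diag : all (fun u => gram conf u u == 0) (iota 0 12).
Proof. by vm_compute. Qed.

Lemma conf_orth : C *m C^T = 5%:M.
Proof.
have H : orthogonal_rows conf by vm_compute.
apply/matrixP => i j; rewrite !mxE.
under eq_bigr do rewrite !mxE.
rewrite (sum_iota (fun k => entry conf i k * entry conf j k)).
have /allP/(_ (val j)) := allP H (val i) ltac:(by rewrite mem_iota ltn_ord).
rewrite mem_iota ltn_ord => /(_ isT)/eqP->.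
by rewrite val_eqE; case: eqP.
Qed.

Lemma pull_orth A g : A *m A^T = 5%:M -> pull A g *m (pull A g)^T = 5%:M.
Proof.
move=> AA; rewrite /pull !trmx_mul trmxK !mulmxA -(mulmxA _ (val g)).
rewrite hyperoct_mulmxT mulmx1 -(mulmxA _ A) AA mul_mx_scalar -scalemxAl.
by rewrite hyperoct_trmxK scalemx1.
Qed.

Definition conf_of g := tpull conf (code g).

Lemma pull_conf g : pull C g = table (conf_of g).
Proof. exact: pull_table. Qed.

Lemma conf_ofE g i j : (i < 6)%N -> (j < 6)%N ->
  entry (conf_of g) i j = gram conf (nth 0%N (code g) i) (nth 0%N (code g) j).
Proof. exact: nth_mktable. Qed.

Lemma orthogonal_conf_of g : orthogonal_rows (conf_of g).
Proof.
apply/allP => i; rewrite mem_iota => i6; apply/allP => j; rewrite mem_iota => j6.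
have /matrixP/(_ (Ordinal i6) (Ordinal j6)) := pull_orth g conf_orth.
rewrite pull_conf !mxE; under eq_bigr do rewrite !mxE.
rewrite (sum_iota (fun k => entry (conf_of g) i k * entry (conf_of g) j k)) => ->.
by rewrite -val_eqE /=; case: (i =P j).
Qed.

Lemma table_topp t : table (topp (mktable t)) = - table (mktable t).
Proof.
apply/matrixP => i j; rewrite !mxE /entry /topp.
by rewrite (nth_map [::]) ?size_mkseq // (nth_map 0) // nth_mkseq ?size_mkseq.
Qed.

(** * Finite checks for the three types of maximal subgroup *)

(** The position in [reps] of the representative of the orbit of the edge {i, j}
under the codes [cs], for the action on the complete graph whose vertices are
the six coordinate lines. *)
Definition edge_class (cs : seq (seq nat)) (reps : seq (nat * nat)) i j :=
  find (fun p => has (fun c =>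
      let a := line (nth 0%N c p.1) in let b := line (nth 0%N c p.2) in
      (a == i) && (b == j) || (a == j) && (b == i)) cs) reps.

(** The matrix C with the entries over each orbit of edges multiplied by the
corresponding letter of [w]. *)
Definition rescaled cs reps (w : seq int) :=
  mktable (fun i j => entry conf i j * nth 0 w (edge_class cs reps i j)).

(** The letter 0 is allowed so that one need not know beforehand that the
off-diagonal entries of C^g are nonzero: orthogonality excludes it later. *)
Fixpoint sign_words n : seq (seq int) :=
  if n is n'.+1 then [seq a :: w | a <- [:: 0; 1; -1], w <- sign_words n']
  else [:: [::]].

Lemma mem_sign_words w :
  all (fun a => a \in [:: 0; 1; -1]) w -> w \in sign_words (size w).
Proof.
elim: w => // a w IHw /andP[aS /IHw wS].
by apply/allpairsP; exists (a, w).
Qed.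

(** A Sylow p-subgroup of the icosahedral group: the rotations of order 5 about
e_6, generated by g_2 g_3; the group generated by g_3; the centraliser of the
involution g_2, a Klein four-group. *)
Definition axis_codes (p : nat) : seq (seq nat) :=
  if p == 5%N then traject (cmul (cmul code2 code3)) (iota 0 6) 5%N
  else if p == 3%N then traject (cmul code3) (iota 0 6) 3%N
  else [seq c <- icosa_codes | cmul c code2 == cmul code2 c].

(** An element h of B6 such that C^h is, up to sign, the only other conference
matrix invariant under the normaliser of the Sylow subgroup above. For p = 5 it
reverses the axis e_6; for p = 3 it reverses e_2, e_3, e_4, one of the two
orbits of g_3 on the lines. *)
Definition twin_code (p : nat) : seq nat :=
  if p == 5%N then [:: 0; 1; 2; 3; 4; 11]%N
  else if p == 3%N then [:: 0; 7; 8; 9; 4; 5]%N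
  else [:: 0; 1; 10; 3; 5; 2]%N.

(** The normaliser of the Sylow subgroup has orbits on the fifteen edges of sizes
5, 5, 5 for p = 5, of sizes 6, 3, 3, 3 for p = 3 and of sizes 12, 3 for p = 2. *)
Definition edge_reps (p : nat) : seq (nat * nat) :=
  if p == 5%N then [:: (0, 1); (0, 2); (0, 5)]%N
  else if p == 3%N then [:: (0, 1); (1, 2); (0, 3); (0, 4)]%N
  else [:: (0, 1); (0, 5)]%N.

Definition twin_conf p := tpull conf (twin_code p).
(** The elements of the icosahedral group that fix the second matrix as well. This
is the normaliser of the Sylow subgroup: dihedral of order 10, dihedral of order
6 or tetrahedral for p = 5, 3, 2. *)
Definition common_codes p :=
  [seq c <- icosa_codes | tpull (twin_conf p) c == twin_conf p].

Local Notation for_p f := (all f [:: 2; 3; 5]%N).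

Lemma axis_codes_group : for_p (fun p => let S := axis_codes p in
  [&& uniq S, size S == (p ^ logn p 60)%N, iota 0 6 \in S, all (mem icosa_codes) S
    & all (fun c => all (fun d => cmul c d \in S) S) S]).
Proof. by vm_compute. Qed.

(** Sylow subgroups of the icosahedral group intersect trivially, so an element
that conjugates one nontrivial member of S into S normalises S; the normaliser of
S fixes the second conference matrix. *)
Lemma axis_codes_TI : for_p (fun p => let S := axis_codes p in
  let t := twin_conf p in
  all (fun c => all (fun d =>
    if (c != iota 0 6) && has (fun e => cmul c d == cmul d e) S
    then tpull t d == t else true) icosa_codes) S).
Proof. by vm_compute. Qed.

Lemma common_codes_twin : for_p (fun p =>
  all (intertwines (twin_code p)) (common_codes p)).
Proof. by vm_compute. Qed.

Lemma common_codes_proper : for_p (fun p => ~~ all (mem (common_codes p)) icosa_codes).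
Proof. by vm_compute. Qed.

Lemma twin_code_valid : for_p (fun p => let c := twin_code p in
  [&& size c == 6, all (fun v => v < 12)%N c & uniq (map line c)]).
Proof. by vm_compute. Qed.

Lemma edge_reps_lt : for_p (fun p =>
  all (fun e => (e.1 < 6)%N && (e.2 < 6)%N) (edge_reps p)).
Proof. by vm_compute. Qed.

Lemma edge_class_lt : for_p (fun p =>
  let cs := common_codes p in let es := edge_reps p in
  all (fun i => all (fun j =>
    if i == j then true else (edge_class cs es i j < size es)%N)
  (iota 0 6)) (iota 0 6)).
Proof. by vm_compute. Qed.

(** The two conference matrices and their opposites are the only rescalings of C,
constant over the orbits of edges, that are again conference matrices. For p = 5,
say, if the star at e_6, the pentagon and the pentagram get the letters a, b, c,
then the orthogonality of the last row to the others forces b = c. *)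
Lemma orthogonal_rescaled : for_p (fun p =>
  let cs := common_codes p in let es := edge_reps p in let t := twin_conf p in
  all (fun w => let r := rescaled cs es w in
    if orthogonal_rows r then r \in [:: conf; topp conf; t; topp t] else true)
  (sign_words (size es))).
Proof. by vm_compute. Qed.

(** * The twin of the icosahedral group *)

Lemma twin_exists p : p \in [:: 2; 3; 5]%N -> exists h, code h = twin_code p.
Proof.
by move=> /(allP twin_code_valid)/and3P[/eqP c6 c12 cU]; apply: code_surj.
Qed.

(** The signs of the vertices cancel: the entrywise product of two matrices
invariant under a signed permutation is invariant under the underlying
permutation of the lines. *)
Lemma edge_weight t u v : gram t u v * gram conf u v =
  entry t (line u) (line v) * entry conf (line u) (line v).
Proof.
rewrite /gram mulrACA.
by rewrite /vsign; do 2![case: ifP => _]; rewrite ?mulr1 ?mulrN1 ?opprK ?mul1r.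
Qed.

Lemma conf_sq : all (fun i => all (fun j =>
   entry conf i j * entry conf i j == (i != j)%:R) (iota 0 6)) (iota 0 6).
Proof. by vm_compute. Qed.

Lemma conf_of_diag g i : (i < 6)%N -> entry (conf_of g) i i = 0.
Proof.
move=> i6; rewrite conf_ofE //; apply/eqP/(allP gram_diag).
by rewrite mem_iota nth_code_lt.
Qed.

Lemma conf_of_sym g i j : (i < 6)%N -> (j < 6)%N ->
  entry (conf_of g) i j = entry (conf_of g) j i.
Proof.
move=> i6 j6; rewrite !conf_ofE //; apply/eqP.
by apply: (allP (allP gram_sym _ _)); rewrite mem_iota nth_code_lt.
Qed.

Lemma conf_of_mem g i j : (i < 6)%N -> (j < 6)%N ->
  entry (conf_of g) i j \in [:: 0; 1; -1].
Proof.
move=> i6 j6; rewrite conf_ofE //.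
by apply: (allP (allP gram_mem _ _)); rewrite mem_iota nth_code_lt.
Qed.

Section Twin.

Variables (p : nat) (h : B6).
Hypotheses (p235 : p \in [:: 2; 3; 5]%N) (hE : code h = twin_code p).

Let E := icosa :&: stab (pull C h).

Lemma pull_twin : pull C h = table (twin_conf p).
Proof. by rewrite pull_conf /conf_of hE. Qed.

Lemma stab_twinE x : (x \in stab (pull C h)) = (tpull (twin_conf p) (code x) == twin_conf p).
Proof.
rewrite pull_twin; apply/stabP/eqP=> [|xt]; last by rewrite pull_table xt.
by rewrite pull_table => /table_mktable_inj.
Qed.

Lemma common_codesE x : (x \in E) = (code x \in common_codes p).
Proof. by rewrite in_setI stab_twinE mem_icosa [RHS]mem_filter andbC. Qed.

Lemma common_sub_twin : E \subset icosa :^ h.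
Proof.
apply/subsetP => x; rewrite common_codesE => xE; apply: mem_icosaJ.
by rewrite hE; apply: allP (allP common_codes_twin p p235) _ xE.
Qed.

Lemma common_proper : E \proper icosa.
Proof.
rewrite properE subsetIl; apply: contra (allP common_codes_proper p p235).
move/subsetP=> IE; apply/allP => c /icosa_codesP[x xI <-].
by have := IE x xI; rewrite common_codesE.
Qed.

(** Otherwise the icosahedral group would fix the second conference matrix too. *)
Lemma twin_neq : icosa :^ h != icosa.
Proof.
apply/negP=> /eqP hI; have := common_proper; rewrite properE => /andP[_ /negP[]].
by rewrite subsetI subxx -{1}hI icosaJ_stab.
Qed.

(** Conjugate L into the chosen Sylow subgroup S. A nontrivial element of L is
moved by each element of M inside L, hence inside S, and the trivial intersection
property applies. *)
Lemma normal_in_common (L M : {group B6}) : M \subset icosa -> L <| M ->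
  p.-group L -> L :!=: 1%g -> exists2 x, x \in icosa & M :^ x \subset E.
Proof.
move=> sMI /andP[sLM nLM] pL ntL.
have /and5P[SU /eqP Sp S1 SI SM] := allP axis_codes_group p p235.
have Sgrp : group_set [set x | code x \in axis_codes p].
  apply/group_setP; split=> [|x y]; rewrite !in_set ?code1 // codeM => xS yS.
  exact: allP (allP SM _ xS) _ yS.
pose S := Group Sgrp.
have oS : #|S| = (60`_p)%N by rewrite p_part -Sp (card_code_set SU) //; apply/allP.
have sylS : p.-Sylow(icosa_group) S.
  rewrite pHallE oS card_icosa eqxx andbT; apply/subsetP => x.
  by rewrite in_set mem_icosa => /(allP SI).
have [x xI sLS] := Sylow_subJ sylS (subset_trans sLM sMI) pL.
exists x^-1%g; first by rewrite (groupVr (G := icosa_group)).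
have [l lL nt_l] := trivgPn _ ntL.
apply/subsetP => _ /imsetP[m mM ->].
have yI : (m ^ x^-1)%g \in icosa.
  exact: (@groupJ _ icosa_group _ _ (subsetP sMI m mM) (groupVr xI)).
have inS z : z \in L -> code (z ^ x^-1)%g \in axis_codes p.
  by move=> /(subsetP sLS); rewrite mem_conjg in_set.
rewrite common_codesE mem_filter -mem_icosa yI andbT.
have := allP (allP (allP axis_codes_TI p p235) _ (inS l lL)) (code (m ^ x^-1)%g).
rewrite -mem_icosa => /(_ yI); rewrite ifT //; apply/andP; split.
  rewrite -code1 (inj_eq code_inj); apply: contra nt_l => /eqP lx.
  by rewrite -(conjgKV x l) lx conj1g.
have lmL : (l ^ m)%g \in L by rewrite memJ_norm // (subsetP nLM).
apply/hasP; exists (code ((l ^ m) ^ x^-1)%g); first exact: inS.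
by rewrite -!codeM conjJg -conjgC.
Qed.

(** The core of the uniqueness: if C^g is fixed by E, its entrywise product with C
is a weight that is constant on the orbits of E on the edges, so C^g is one of the
few matrices examined in [orthogonal_rescaled]. *)
Lemma twin_unique g : E \subset icosa :^ g ->
  icosa :^ g = icosa \/ icosa :^ g = icosa :^ h.
Proof.
move=> sEg; set t := conf_of g.
pose s i j := entry t i j * entry conf i j.
(* the facts about the matrices C^g also apply to C, with g = 1 *)
have conf1 : conf_of 1%g = conf by rewrite /conf_of code1; vm_compute.
have s_sym i j : (i < 6)%N -> (j < 6)%N -> s i j = s j i.
  by move=> i6 j6; rewrite /s conf_of_sym // -conf1 [X in _ * X]conf_of_sym.
have s_inv c i j : c \in common_codes p -> (i < 6)%N -> (j < 6)%N ->
    s (line (nth 0%N c i)) (line (nth 0%N c j)) = s i j.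
  rewrite mem_filter => /andP[ct cI] i6 j6.
  have [x xI xc] := icosa_codesP cI; rewrite -xc /s -edge_weight.
  rewrite (pull_confE (icosa_conf xI) i6 j6); congr (_ * _).
  have xE : x \in E by rewrite in_setI xI stab_twinE xc.
  have /stabP := subsetP (icosaJ_stab g) _ (subsetP sEg _ xE).
  move=> /matrixP/(_ (Ordinal i6) (Ordinal j6)).
  by rewrite pull_conf pullE mxE.
pose es := edge_reps p; pose cs := common_codes p.
pose w := [seq s e.1 e.2 | e <- es].
have es6 e : e \in es -> (e.1 < 6)%N /\ (e.2 < 6)%N.
  by move=> /(allP (allP edge_reps_lt p p235))/andP.
have tE : t = rescaled cs es w.
  apply: mktable_eq => i j i6 j6; rewrite -conf_ofE // -/t.
  have [<-|ij] := eqVneq i j.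
    by rewrite conf_of_diag // -conf1 conf_of_diag // mul0r.
  have i6' : i \in iota 0 6 by rewrite mem_iota.
  have j6' : j \in iota 0 6 by rewrite mem_iota.
  have := allP (allP (allP edge_class_lt p p235) i i6') j j6'.
  rewrite (negPf ij) => lt_k; rewrite (nth_map (0, 0)%N) //.
  set e := nth _ _ _; have eE : e \in es by apply: mem_nth.
  have [e1 e2] := es6 e eE.
  (* some element of E sends the representative to the edge {i, j}, in one of its
     two orientations *)
  have -> : s e.1 e.2 = s i j.
    have := lt_k; rewrite -has_find => /(nth_find (0, 0)%N)/hasP[c cE].
    rewrite -[LHS](s_inv c _ _ cE e1 e2).
    case/orP=> /andP[/eqP-> /eqP->]; first by [].
    exact: s_sym.
  have /eqP sq1 := allP (allP conf_sq i i6') j j6'.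
  by rewrite /s mulrCA sq1 ij mulr1.
have wS : w \in sign_words (size es).
  have -> : size es = size w by rewrite size_map.
  apply: mem_sign_words; apply/allP => _ /mapP[e /es6[e1 e2] ->].
  have := conf_of_mem 1%g e1 e2; rewrite conf1 /s.
  have := conf_of_mem g e1 e2; rewrite -/t !inE.
  by move=> /or3P[]/eqP-> /or3P[]/eqP->.
have := allP (allP orthogonal_rescaled p p235) w wS; cbv zeta.
rewrite -/es -/cs -tE (orthogonal_conf_of g : orthogonal_rows t).
rewrite !in_cons in_nil orbF.
have negE (r : seq (seq int)) : t = topp r -> (exists f, r = mktable f) ->
   pull C g = - table r.
  by move=> tr [f rf]; rewrite pull_conf -/t tr rf table_topp.
case/or4P=> /eqP t_eq.
- by left; rewrite -[RHS]conjsg1; apply: icosaJ_eq; left; rewrite pull1 pull_conf -/t t_eq.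
- left; rewrite -[RHS]conjsg1; apply: icosaJ_eq; right; rewrite pull1 (negE conf) //.
  by exists (fun i j => entry conf i j); vm_compute.
- by right; apply: icosaJ_eq; left; rewrite pull_twin pull_conf -/t t_eq.
- by right; apply: icosaJ_eq; right; rewrite pull_twin; apply: negE t_eq _; eexists.
Qed.

End Twin.

(** * Maximal subgroups *)

(** Among the proper divisors of 60 only 30 has three prime factors, and a
subgroup of index 2 would be normal; Burnside's theorem applies to the others. *)
Lemma simple60_proper_solvable (gT : finGroupType) (G M : {group gT}) :
  simple G -> #|G| = 60%N -> M \proper G -> solvable M.
Proof.
move=> simG oG pMG; apply: Burnside_p_a_q_b.
have [sMG not_sGM] := andP pMG.
have dM : #|M| \in divisors 60 by rewrite -dvdn_divisors // -oG cardSg.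
have nM60 : #|M| != 60%N.
  by apply: contraNneq not_sGM => M60; rewrite (index1g sMG) // -divgS // oG M60.
have nM30 : #|M| != 30%N.
  apply: contraNneq not_sGM => M30.
  have nsMG : M <| G by apply: index2_normal; rewrite // -divgS // oG M30.
  have [_ /(_ M nsMG)[M1|->//]] := simpleP _ simG.
  by rewrite M1 cards1 in M30.
move: dM nM60 nM30; rewrite (_ : divisors 60 = [:: 1; 2; 3; 4; 5; 6; 10; 12; 15; 20; 30; 60])%N //.
by rewrite !inE; do ![case/orP => [/eqP->|] //]; move/eqP->.
Qed.

Lemma icosa_conj x : x \in icosa -> icosa :^ x = icosa.
Proof. exact: (@conjGid _ icosa_group). Qed.

(** A proper subgroup is solvable, so it has a minimal normal subgroup that is a
p-group, with p equal to 2, 3 or 5. *)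
Lemma proper_in_common (M : {group B6}) : simple icosa -> M \proper icosa ->
  exists p h x, [/\ p \in [:: 2; 3; 5]%N, code h = twin_code p, x \in icosa
    & M :^ x \subset icosa :&: stab (pull C h)].
Proof.
move=> simI pMI; have sMI := proper_sub pMI.
have [M1|ntM] := eqVneq (M : {set B6}) 1%g.
  have [h hE] := @twin_exists 2 isT.
  exists 2%N, h, 1%g; split; [by [] | exact: hE | exact: (@group1 _ icosa_group) | ].
  by rewrite conjsg1 M1 sub1set (@group1 _ (icosa_group :&: stab_group _)).
have [L minL sLM] := minnormal_exists ntM (normG M).
have solM := simple60_proper_solvable (G := icosa_group) simI card_icosa pMI.
have [_ ntL /is_abelemP[p p_pr abelL]] := minnormal_solvable minL sLM solM.
have pL := abelem_pgroup abelL.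
have nsLM : L <| M by rewrite /normal sLM; have [/andP[]] := mingroupP minL.
have p235 : p \in [:: 2; 3; 5]%N.
  have [_ pL_dvd _] := pgroup_pdiv pL ntL.
  have p60 : (p %| 60)%N.
    rewrite -card_icosa; apply: dvdn_trans pL_dvd _.
    exact: (@cardSg _ icosa_group) (subset_trans sLM sMI).
  have : p \in primes 60 by rewrite mem_primes p_pr.
  by [].
have [h hE] := twin_exists p235.
have [x xI sME] := normal_in_common p235 hE sMI nsLM pL ntL.
by exists p, h, x.
Qed.

(** A maximal subgroup is conjugate to one of the three groups E, whose twins are
known; the conclusion is transported back by the conjugating element. *)
Theorem maximal_twin (M : {group B6}) : simple icosa -> maximal M icosa ->
  exists h, [/\ icosa :^ h != icosa, M \subset icosa :^ h
    & forall g, M \subset icosa :^ g ->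
      icosa :^ g = icosa \/ icosa :^ g = icosa :^ h].
Proof.
move=> simI maxM; have [pMI max_M] := maxgroupP maxM.
have [p [h [x [p235 hE xI sME]]]] := proper_in_common simI pMI.
have MxE : M :^ x = icosa :&: stab (pull C h).
  have maxMx : maximal (M :^ x) icosa by rewrite -(icosa_conj xI) maximalJ.
  have [_ max_Mx] := maxgroupP maxMx.
  apply/esym/(max_Mx (icosa_group :&: stab_group (pull C h))%G) => //.
  exact: common_proper p235 hE.
have subMx g : (M \subset icosa :^ (g * x^-1)) = (M :^ x \subset icosa :^ g).
  by rewrite conjsgM -sub_conjg.
have conj_eq g g' : icosa :^ (g * x) = icosa :^ g' -> icosa :^ g = icosa :^ (g' * x^-1).
  by move=> gg'; rewrite conjsgM -gg' conjsgM conjsgK.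
exists (h * x^-1)%g; split.
- apply: contra (twin_neq p235 hE) => /eqP hx; apply/eqP.
  by rewrite -[RHS](icosa_conj xI) -[in RHS]hx -conjsgM mulgKV.
- by rewrite subMx MxE (common_sub_twin p235 hE).
move=> g sMg; have := twin_unique p235 hE (g := (g * x)%g).
rewrite -MxE -subMx mulgK => /(_ sMg)[gI|gh]; [left | by right; apply: conj_eq].
rewrite -[RHS](icosa_conj (x := x^-1%g)) ?(groupVr (G := icosa_group)) //.
by rewrite -[in RHS](conjsg1 icosa) -conjsgM; apply: conj_eq; rewrite conjsg1.
Qed.

(** * The representation on R^6 *)

(** The matrix with a given code, used for sums of group elements, which are not in
B6 any more. *)
Definition code_mx c : 'M[int]_6 := \matrix_(i, k) vcoord (nth 0%N c k) i.

Lemma code_mxE x : code_mx (code x) = x.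
Proof.
by apply/matrixP => i k; rewrite -[RHS]mulmx_vtxE mulmx_vtx // !mxE.
Qed.

Lemma sum_code_mxE (s : seq (seq nat)) (i k : 'I_6) :
  (\sum_(c <- s) code_mx c) i k = sumz [seq vcoord (nth 0%N c k) i | c <- s].
Proof.
rewrite summxE; elim: s => [|c s IHs]; first by rewrite big_nil.
by rewrite big_cons IHs mxE.
Qed.

(** The elements x with tr(C x) = 5: a conjugacy class of twelve rotations of order
5. Its sum is central in the group algebra and acts as 2 + 2 C. *)
Definition positive_codes :=
  [seq c <- icosa_codes | sumz (mkseq (fun k => gram conf k (nth 0%N c k)) 6) == 5].

Lemma axis_sum : all (fun i => all (fun k =>
    sumz [seq vcoord (nth 0%N c k) i | c <- axis_codes 5] ==
    (if (i == 5%N) && (k == 5%N) then 5 else 0) + entry conf i 5 * entry conf 5 k)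
  (iota 0 6)) (iota 0 6).
Proof. by vm_compute. Qed.

Lemma positive_sum : all (fun i => all (fun k =>
    sumz [seq vcoord (nth 0%N c k) i | c <- positive_codes] ==
    (if i == k then 2 else 0) + 2 * entry conf i k)
  (iota 0 6)) (iota 0 6).
Proof. by vm_compute. Qed.

Lemma axis_to_line : all (fun i =>
  has (fun c => line (nth 0%N c 5) == i) icosa_codes) (iota 0 6).
Proof. by vm_compute. Qed.

Lemma table_ordP (f g : nat -> nat -> int) (i k : 'I_6) :
  all (fun i => all (fun k => f i k == g i k) (iota 0 6)) (iota 0 6) ->
  f i k = g i k.
Proof.
have i6 (j : 'I_6) : val j \in iota 0 6 by rewrite mem_iota ltn_ord.
by move=> H; apply/eqP/(allP (allP H _ (i6 i)) _ (i6 k)).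
Qed.

(** The rotations about e_6 fix e_6 and permute cyclically the five other lines, with
signs that preserve the last column c of C; hence their sum is
5 e_6 e_6^T + c c^T. *)
Lemma axis_sumE : \sum_(c <- axis_codes 5) code_mx c =
  5 *: delta_mx ord_max ord_max + col ord_max C *m row ord_max C.
Proof.
apply/matrixP => i k; rewrite sum_code_mxE (table_ordP i k axis_sum).
rewrite !mxE big_ord1 !mxE -!val_eqE /=.
by case: ifP; rewrite ?mulr1 ?mulr0.
Qed.

Lemma positive_sumE : \sum_(c <- positive_codes) code_mx c = 2%:M + 2 *: C.
Proof.
apply/matrixP => i k; rewrite sum_code_mxE (table_ordP i k positive_sum).
by rewrite !mxE -val_eqE /=; case: (val i =P val k).
Qed.

Lemma conf_tr : C^T = C.
Proof.
apply/matrixP => i j; rewrite mxE !mxE.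
apply: (table_ordP (f := fun i j => entry conf j i) (g := entry conf)).
by vm_compute.
Qed.

Lemma scalar_mxN (R : pzRingType) n (a : R) : (- a)%:M = - a%:M :> 'M_n.
Proof. by apply/matrixP => i j; rewrite !mxE mulNrn. Qed.

Section Eigen.

Variables (R : realType) (gT : finGroupType) (I : {group gT}).
Variable f : {morphism I >-> B6}.
Hypothesis fI : (f @* I)%g = icosa.

Let rG := natural_repr R f.
Let D : 'M[R]_6 := map_mx intr C.

Lemma natural_conf (x : gT) : x \in I -> D *m rG x = rG x *m D.
Proof.
move=> Ix; rewrite -!map_mxM; congr map_mx; apply/pull_commP/icosa_conf.
by rewrite -fI mem_morphim.
Qed.

(** The eigenvalues of C over the reals are therefore sqrt 5 and - sqrt 5; the
eigenspace of s is the row space of C + s. *)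
Lemma sqr_conf : D *m D = 5%:M.
Proof.
rewrite -map_mxM -[X in _ *m X]conf_tr conf_orth map_scalar_mx /=.
by congr _%:M.
Qed.

Lemma conj_conf : exists2 N : 'M[R]_6, N *m N^T = 1%:M & N^T *m D *m N = - D.
Proof.
have [n [_ nC]] := exists_flip; exists (map_mx intr (val n)).
  by rewrite map_trmx -map_mxM hyperoct_mulmxT map_mx1.
by rewrite map_trmx -!map_mxM -/(pull C n) nC map_mxN.
Qed.

Lemma code_natural c : c \in icosa_codes ->
  exists2 x, x \in I & rG x = map_mx intr (code_mx c).
Proof.
case/icosa_codesP=> y; rewrite -fI => /morphimP[x _ Ix ->] <-.
by exists x; rewrite // code_mxE.
Qed.

(** Submodules are stable under sums of group elements. *)
Lemma code_sum_envelop s : {subset s <= icosa_codes} ->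
  (map_mx intr (\sum_(c <- s) code_mx c) \in enveloping_algebra_mx rG)%MS.
Proof.
move=> sI; rewrite raddf_sum /= linear_sum big_seq summx_sub // => c.
by move=> /sI/code_natural[x Ix <-]; apply: envelop_mx_id.
Qed.

Variable s : R.
Hypothesis s2 : s * s = 5.
Let E := D + s%:M.

Lemma s_neq0 : s != 0.
Proof. by apply: contra_eq_neq s2 => ->; rewrite mul0r eq_sym pnatr_eq0. Qed.

Lemma eigenE : E *m D = s *: E.
Proof.
rewrite mulmxDl mul_scalar_mx sqr_conf scalerDr scale_scalar_mx s2 addrC.
by [].
Qed.

Lemma eigen_sub m (U : 'M_(m, 6)) : (U <= E)%MS -> U *m D = s *: U.
Proof. by case/submxP=> W ->; rewrite -mulmxA eigenE scalemxAr. Qed.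

Lemma eigen_natural (x : gT) : x \in I -> E *m rG x = rG x *m E.
Proof.
by move=> Ix; rewrite mulmxDl mulmxDr natural_conf // scalar_mxC.
Qed.

Lemma eigen_module : mxmodule rG E.
Proof. by apply/mxmoduleP => x Ix; rewrite eigen_natural // submxMl. Qed.

(** On the eigenspace of s, summing over the rotations about e_6 projects onto the
line spanned by the last row of C + s, with a coefficient read off the last
coordinate of u. *)
Lemma eigen_axis (u : 'rV_6) : (u <= E)%MS ->
  u *m map_mx intr (\sum_(c <- axis_codes 5) code_mx c)
    = (s * u 0 ord_max) *: row ord_max E.
Proof.
move=> uE; rewrite axis_sumE map_mxD map_mxZ map_delta_mx map_mxM map_col map_row.
set j := ord_max; rewrite -/D rmorph_nat.
have col_scal (v : 'rV[R]_6) : v *m delta_mx j 0 = (v 0 j)%:M.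
  by rewrite -colE; apply/matrixP => a b; rewrite !ord1 !mxE.
have uj : u *m delta_mx j j = u 0 j *: delta_mx 0 j.
  by rewrite -(mul_delta_mx (0 : 'I_1)) mulmxA col_scal mul_scalar_mx.
have uc : u *m col j D = (s * u 0 j)%:M.
  by rewrite colE mulmxA (eigen_sub uE) col_scal mxE.
rewrite mulmxDr -scalemxAr uj mulmxA uc mul_scalar_mx.
have -> : row j E = row j D + s *: delta_mx 0 j.
  by rewrite linearD /= [row j s%:M]rowE mul_mx_scalar.
by rewrite scalerDr addrC !scalerA mulrAC s2.
Qed.

(** The group is transitive on the coordinate lines. *)
Lemma signed_axis (i : 'I_6) : exists2 x, x \in I & exists2 e : R, e * e = 1 &
  rG x *m delta_mx ord_max 0 = e *: delta_mx i (0 : 'I_1).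
Proof.
have i6 : val i \in iota 0 6 by rewrite mem_iota ltn_ord.
have /hasP[c cI /eqP ci] := allP axis_to_line i i6.
have [x Ix xc] := code_natural cI; exists x; first exact: Ix.
exists (vsign (nth 0%N c 5))%:~R; first by rewrite /vsign; case: ifP; rewrite ?mulrNN mulr1.
rewrite xc -colE; apply/colP => k; rewrite !mxE /vcoord ci.
by rewrite andbT -val_eqE /=; case: ifP => _; rewrite ?mulr1 ?mulr0.
Qed.

Lemma eigen_neq0 : E != 0.
Proof.
apply: contra_neq s_neq0 => /matrixP/(_ ord_max ord_max).
by rewrite !mxE /= add0r.
Qed.

Lemma natural_tr (x : gT) : x \in I -> rG x^-1%g = (rG x)^T.
Proof. by move=> Ix; rewrite /= morphV // map_trmx. Qed.

(** A nonzero vector of a submodule V can be moved so that its last coordinate is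
nonzero; averaging over the rotations about e_6 then puts the last row of C + s
in V, and transitivity on the lines gives all the other rows. *)
Lemma eigen_simple : mxsimple rG E.
Proof.
split; [exact: eigen_module | exact: eigen_neq0 | move=> V modV sVE /rowV0Pn[v sVv nz_v]].
have [i vi] : exists i, v 0 i != 0.
  apply/existsP; apply: contraR nz_v => /existsPn v0; apply/eqP/rowP => i.
  by apply/eqP; rewrite mxE -[_ == _]negbK v0.
have sax : {subset axis_codes 5 <= icosa_codes}.
  by have /and5P[_ _ _ /allP] := allP axis_codes_group 5%N isT.
have Vaxis : (row ord_max E <= V)%MS.
  have [x Ix [e e2 xe]] := signed_axis i.
  have sVvx : (v *m rG x <= V)%MS by apply: mxmodule_trans.
  have vx : (v *m rG x) 0 ord_max = e * v 0 i.
    have := congr1 (fun A : 'M_1 => A 0 0) (congr1 (mulmx v) xe).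
    by rewrite mulmxA -scalemxAr -!colE !mxE.
  have := mxmodule_envelop modV (code_sum_envelop sax) sVvx.
  rewrite eigen_axis ?(submx_trans sVvx) // vx.
  have e0 : e != 0 by apply: contra_eq_neq e2 => ->; rewrite mul0r eq_sym oner_eq0.
  by rewrite eqmx_scale // !mulf_neq0 ?s_neq0.
apply/row_subP => k; have [x Ix [e e2 xe]] := signed_axis k.
(* row ord_max of rG x^-1 is the transpose of column ord_max of rG x *)
have xk : delta_mx 0 ord_max *m rG x^-1%g = e *: delta_mx (0 : 'I_1) k.
  by rewrite natural_tr // -[LHS]trmxK trmx_mul !trmxK trmx_delta xe linearZ /= trmx_delta.
have -> : row k E = e *: (row ord_max E *m rG x^-1%g).
  rewrite (rowE ord_max) -mulmxA eigen_natural ?groupV // mulmxA xk.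
  by rewrite -scalemxAl scalerA e2 scale1r -rowE.
by rewrite scalemx_sub // mxmodule_trans ?groupV.
Qed.

End Eigen.

Section Crystallographic.

Variables (R : realType) (gT : finGroupType) (I : {group gT}).
Variable f : {morphism I >-> B6}.
Hypothesis fI : (f @* I)%g = icosa.

Let rG := natural_repr R f.
Let D : 'M[R]_6 := map_mx intr C.
Let s : R := Num.sqrt 5.
Let V := D + s%:M.
Let W := D + (- s)%:M.

Let s2 : s * s = 5.
Proof. by rewrite -expr2 sqr_sqrtr ?ler0n. Qed.

Let ns2 : - s * - s = 5.
Proof. by rewrite mulrNN s2. Qed.

Lemma eigen_cap : (V :&: W = 0)%MS.
Proof.
apply/eqP/rowV0P => v; rewrite sub_capmx => /andP[vV vW].
have := eigen_sub s2 vV; rewrite (eigen_sub ns2 vW) => /eqP.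
rewrite scaleNr -subr_eq0 -opprD oppr_eq0 -scalerDl scaler_eq0.
by rewrite -mulr2n mulrn_eq0 /= (negPf (s_neq0 s2)) => /eqP.
Qed.

Lemma eigen_add : (V + W :=: 1%:M)%MS.
Proof.
apply/eqmxP; rewrite submx1 /=.
have -> : 1%:M = (s + s)^-1 *: (V - W).
  have -> : V - W = (s + s)%:M.
    by rewrite /V /W scalar_mxN opprB addrC addrA subrK -raddfD.
  rewrite scale_scalar_mx mulVf // -mulr2n mulrn_eq0 /=; exact: s_neq0 s2.
by rewrite scalemx_sub // addmx_sub_adds // eqmx_opp.
Qed.

(** The flip exchanges the two eigenspaces, which have the same dimension and add
up to dimension 6. *)
Lemma eigen_rank : \rank V = 3%N /\ \rank W = 3%N.
Proof.
have eqVW : \rank V = \rank W.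
  have [N NN ND] := conj_conf R.
  have uN : N \in unitmx by case/mulmx1_unit: NN.
  have -> : W = - (N^T *m V *m N).
    rewrite mulmxDr mulmxDl ND mul_mx_scalar -scalemxAl (mulmx1C NN) scalemx1.
    by rewrite /W scalar_mxN opprD opprK.
  rewrite mxrank_opp mxrankMfree ?row_free_unit // eqmxMfull //.
  by rewrite row_full_unit unitmx_tr.
have := mxrank_sum_cap V W; rewrite eigen_cap mxrank0 addn0 eigen_add mxrank1.
rewrite -eqVW => r6; suff -> : \rank V = 3%N by [].
by apply: double_inj; rewrite -addnn -r6.
Qed.

(** The class sum 2 + 2 C of the group algebra acts by the different scalars
2 + 2 s and 2 - 2 s on the two eigenspaces. *)
Lemma eigen_not_iso : ~ mx_iso rG V W.
Proof.
case=> g _ homg VgW.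
have sp : {subset positive_codes <= icosa_codes} by move=> c; rewrite mem_filter => /andP[].
have VD : V *m D = s *: V := eigenE s2.
have WD : V *m g *m D = - s *: (V *m g).
  by have := eigen_sub ns2 (U := V *m g); apply; rewrite VgW.
have := hom_envelop_mxC homg (code_sum_envelop R fI sp).
rewrite positive_sumE map_mxD map_scalar_mx map_mxZ -/D /=.
have -> : V *m (2%:~R%:M + 2%:~R *: D) *m g = (2 + 2 * s) *: (V *m g).
  by rewrite mulmxDr mul_mx_scalar -scalemxAr VD scalerA -scalerDl -scalemxAl.
have -> : V *m g *m (2%:~R%:M + 2%:~R *: D) = (2 + 2 * - s) *: (V *m g).
  by rewrite mulmxDr mul_mx_scalar -scalemxAr WD scalerA -scalerDl.
move/eqP; rewrite -subr_eq0 -scalerBl mulrN opprD opprK addrACA subrr add0r.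
rewrite -mulrDr -mulr2n scaler_eq0 mulf_eq0 !mulrn_eq0 oner_eq0 /=.
rewrite (negPf (s_neq0 s2)) /= => /eqP Vg0.
by have := eigen_neq0 ns2; rewrite -/W -mxrank_eq0 -VgW Vg0 mxrank0.
Qed.

Lemma natural_split : exists T1 T2 : mx_representation R I 3,
  [/\ mx_irreducible T1, mx_irreducible T2, ~ mx_rsim T1 T2 &
      mx_rsim rG (dadd_grepr (Representation T1) (Representation T2))].
Proof.
have modV : mxmodule rG V := eigen_module fI s.
have modW : mxmodule rG W := eigen_module fI (- s).
have irrV : mx_irreducible (submod_repr modV).
  by apply/submod_mx_irr; apply: eigen_simple.
have irrW : mx_irreducible (submod_repr modW).
  by apply/submod_mx_irr; apply: eigen_simple.
have niso : ~ mx_rsim (submod_repr modV) (submod_repr modW).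
  by move/mx_rsim_iso; apply: eigen_not_iso.
have mod1 := mxmodule1 rG.
have dxVW : mxdirect (V + W) by apply/mxdirect_addsP/eigen_cap.
have sim : mx_rsim rG (dadd_grepr (Representation (submod_repr modV))
    (Representation (submod_repr modW))).
  apply: mx_rsim_trans (mx_rsim_sym (rsim_submod1 mod1 (eqmx_refl _))) _.
  by apply: mx_rsim_dadd eigen_add dxVW _ _; apply: mx_rsim_refl.
have [rV rW] := eigen_rank.
(* the degrees are ranks that are only provably equal to 3, hence the abstraction
   of the two representations before the substitution *)
move: (submod_repr modV) (submod_repr modW) irrV irrW niso sim; rewrite rV rW.
by move=> T1 T2 irr1 irr2 n12 sim; exists T1, T2.
Qed.

End Crystallographic.

(** Conjugating by g changes the natural representation into one that is similar to
it, by the matrix of g^-1. *)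
Theorem crystallographicJ (R : realType) (gT : finGroupType) (I : {group gT})
    (f : {morphism I >-> B6}) (H : {group B6}) g :
  (f @* I)%g = icosa -> ('injm f)%g -> H :=: (icosa :^ g)%g ->
  crystallographic R I H.
Proof.
move=> fI injf HE.
have fgM : {in I &, {morph (fun a => f a ^ g)%g : a b / (a * b)%g}}.
  by move=> a b Ia Ib; rewrite morphM // conjMg.
exists (Morphism fgM).
  split; first by apply/injmP => a b Ia Ib /conjg_inj; apply: (injmP injf).
  by rewrite HE -fI !morphimEdom /conjugate -imset_comp.
have [T1 [T2 [irr1 irr2 n12 sim]]] := natural_split R fI.
exists T1, T2; split; [exact: irr1 | exact: irr2 | exact: n12 |].
apply: mx_rsim_trans sim.
exists (map_mx intr (val g^-1%g)); [by [] | | move=> a Ia].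
  rewrite row_free_unit; apply: (proj1 (mulmx1_unit (B := map_mx intr (val g)) _)).
  by rewrite -map_mxM /= hyperoct_trmxK map_mx1.
rewrite -!map_mxM; congr map_mx; rewrite -[LHS]/(val (f a ^ g * g^-1)%g).
by rewrite conjgE -mulgA mulgK.
Qed.

(** * The theorem *)

Lemma code_basis_images x c : size c = 6%N -> all (fun v => v < 12)%N c ->
  basis_images x = map vtx c -> code x = c.
Proof.
move=> c6 /allP c12 xc; apply: (@eq_from_nth _ 0%N) => [|k].
  by rewrite size_code c6.
rewrite size_code => k6; have k6c : (k < size c)%N by rewrite c6.
rewrite nth_code // -basis_vecE //.
have -> : x *m basis_vec k.+1 = vtx (nth 0%N c k).
  rewrite -(nth_map _ 0) // -xc (nth_map 0%N) ?size_iota //.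
  by rewrite nth_iota.
by rewrite index_vtx // c12 // mem_nth.
Qed.

Lemma basis_vecN v : (v < 6)%N -> - basis_vec v.+1 = vtx (v + 6).
Proof.
by move=> v6; rewrite basis_vecE // -vtx_antipode ?(leq_trans v6) // /antipode v6.
Qed.

Local Open Scope group_scope.

Theorem proposition5p3 (R : realType) (gT : finGroupType) (I : {group gT})
    (g2 g3 : gT) (Ihat : {morphism I >-> B6})
    (I_A5 : I \isog 'Alt_('I_5))
    (I_gen : <<[set g2; g3]>> = I)
    (g2_2 : g2 ^+ 2 = 1) (g3_3 : g3 ^+ 3 = 1) (g23_5 : (g2 * g3) ^+ 5 = 1)
    (Ihat_inj : 'injm Ihat)
    (Ihat_g2 : basis_images (Ihat g2) = Ihat_g2_images)
    (Ihat_g3 : basis_images (Ihat g3) = Ihat_g3_images)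
    (G : {group gT}) (G_max : maximal G I)
    (P : {group B6}) (P_conj : gval P \in conj_class (Ihat @* G)) :
  exists H1 H2 : {group B6},
    [/\ crystallographic R I H1 /\ gval H1 \in conj_class (Ihat @* I),
        crystallographic R I H2 /\ gval H2 \in conj_class (Ihat @* I),
        H1 != H2,
        P :=: H1 :&: H2
      & forall K1 K2 : {group B6},
          gval K1 \in conj_class (Ihat @* I) ->
          gval K2 \in conj_class (Ihat @* I) ->
          P :=: K1 :&: K2 ->
          [set K1; K2] = [set H1; H2]].
Proof.
have Ihat_code2 : code (Ihat g2) = code2.
  by apply: code_basis_images; rewrite // Ihat_g2 /Ihat_g2_images !basis_vecN // !basis_vecE.
have Ihat_code3 : code (Ihat g3) = code3.
  by apply: code_basis_images; rewrite // Ihat_g3 /Ihat_g3_images !basis_vecN // !basis_vecE.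
have oI : #|I| = 60%N.
  rewrite (card_isog I_A5); apply: double_inj.
  by rewrite -mul2n card_Alt card_ord.
have IhatI : (Ihat @* I)%g = icosa.
  apply/eqP; rewrite eqEcard card_icosa card_injm // oI leqnn andbT.
  have sgI : [set g2; g3] \subset I by rewrite -I_gen subset_gen.
  suff : (Ihat @* <<[set g2; g3]>>)%g \subset icosa by rewrite I_gen.
  rewrite morphim_gen // (@gen_subG _ _ icosa_group).
  apply/subsetP => _ /morphimP[x _ /set2P[]-> ->]; rewrite mem_icosa.
    by rewrite Ihat_code2; vm_compute.
  by rewrite Ihat_code3; vm_compute.
have simI : simple icosa.
  rewrite -IhatI -(isog_simple (sub_isog (subxx I) Ihat_inj)) (isog_simple I_A5).
  by apply: simple_Alt5; rewrite card_ord.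
have sGI : G \subset I by apply/proper_sub; have [] := maxgroupP G_max.
have maxM : maximal (Ihat @* G)%G icosa by rewrite -IhatI injm_maximal.
have [h [hI sMh uniq_h]] := maximal_twin simI maxM.
have /imsetP[y _ PE] := P_conj; rewrite IhatI.
have class_icosa g : icosa :^ g \in conj_class icosa by apply: imset_f.
have cryst g : crystallographic R I (icosa_group :^ g)%G.
  exact: crystallographicJ IhatI Ihat_inj _.
(* everything is moved by the element y that conjugates K_G to P *)
have twins (K : {group B6}) : gval K \in conj_class icosa -> P \subset K ->
    K :=: icosa :^ y \/ K :=: icosa :^ (h * y).
  case/imsetP=> g _ -> sPg.
  have sMg : (Ihat @* G)%g \subset icosa :^ (g * y^-1).
    by rewrite conjsgM -sub_conjg -PE.
  rewrite -[g](mulgKV y) !conjsgM.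
  by case: (uniq_h _ sMg); rewrite conjsgM => ->; [left | right].
have [pMI max_M] := maxgroupP maxM.
have meetM : icosa :&: icosa :^ h = (Ihat @* G)%g.
  apply: (max_M (icosa_group :&: icosa_group :^ h)%G); last first.
    by rewrite subsetI (proper_sub pMI).
  rewrite properE subsetIl subsetI subxx; apply: contra hI => sIh.
  by rewrite eq_sym eqEcard cardJg leqnn andbT.
have PIH : P :=: icosa :^ y :&: icosa :^ (h * y).
  by rewrite PE -meetM conjIg conjsgM.
(* so K1 and K2 are distinct, as P has fewer than 60 elements *)
have P_neq g : P :!=: icosa :^ g.
  apply: contraTneq (proper_card pMI) => Pg.
  by rewrite -(cardJg (Ihat @* G)%g y) -PE Pg cardJg ltnn.
exists (icosa_group :^ y)%G, (icosa_group :^ (h * y))%G; split.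
- by split; [apply: cryst | apply: class_icosa].
- by split; [apply: cryst | apply: class_icosa].
- by rewrite -val_eqE /= conjsgM (inj_eq (can_inj (conjsgK y))) eq_sym.
- exact: PIH.
move=> K1 K2 K1C K2C PK.
have sPK : (P \subset K1) && (P \subset K2) by rewrite -subsetI -PK.
have [/(twins K1 K1C) K1E /(twins K2 K2C) K2E] := andP sPK.
have K12 : K1 :!=: K2.
  apply: contraNneq (P_neq y) => K12; have PK1 : P :=: K1 by rewrite PK -K12 setIid.
  by case: K1E PK1 => -> PK1; [apply/eqP | case/eqP: (P_neq (h * y)%g)].
case: K1E K2E K12 => [K1E|K1E] [K2E|K2E]; rewrite K1E K2E ?eqxx // => _.
- by congr [set _; _]; apply: val_inj.
- by rewrite setUC; congr [set _; _]; apply: val_inj.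
Qed.
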